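(* Let $0<\lambda<1$, $0=b_1<b_2<\dots<b_N=1-\lambda$, $\tau_{b_i}(x)=\lambda x+b_i$ on $\mathbb{R}$, weights $p_1,\dots,p_N>0$ summing to $1$, $X\subset[0,1]$ the attractor and $\mu$ the self-similar measure $\mu=\sum_{i=1}^Np_i\mu\circ\tau_{b_i}^{-1}$. Suppose $0<\mathcal{H}^\alpha(X)<\infty$ and $\mu\ll\mathcal{H}^\alpha|_X$. Then: (i) if $\mu$ admits a frame measure, then $p_1=p_N$; (ii) if $\alpha=1$ (i.e. $\mu\ll\mathcal{L}|_X$) and $\mu$ admits a frame measure, then $p_j\le\lambda$ for all $j$ and $p_1=p_N=\lambda$.
   Context: $\mathcal{H}^\alpha$ is $\alpha$-dimensional Hausdorff measure, $\mathcal{L}$ Lebesgue measure; the attractor $X$ is the unique nonempty compact set with $X=\bigcup_i\tau_{b_i}(X)$. A frame measure for $\mu$ is a Borel measure $\nu$ on $\mathbb{R}$ with $A\|f\|_{L^2(\mu)}^2\le\|\widehat{f\,d\mu}\|_{L^2(\nu)}^2\le B\|f\|_{L^2(\mu)}^2$ for all $f\in L^2(\mu)$, some $A,B>0$, with $\widehat{f\,d\mu}(t)=\int f(x)e^{-2\pi itx}d\mu(x)$. *)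

(* Defs.v *)
From HB Require Import structures.
From mathcomp Require Import all_boot all_order all_algebra.
From mathcomp Require Import all_classical all_reals all_analysis.
Set Implicit Arguments. Unset Strict Implicit. Unset Printing Implicit Defensive.
Import Order.TTheory GRing.Theory Num.Theory.
Import numFieldNormedType.Exports.
Local Open Scope classical_set_scope.
Local Open Scope ring_scope.

Definition tau {R : realType} (lam b : R) (x : R) : R := lam * x + b.

(* diameter of a subset of R, in the extended reals (-oo for the empty set) *)
Definition diam {R : realType} (U : set R) : \bar R :=
  ereal_sup [set (`|x - y|)%:E | x in U & y in U].

Definition hterm {R : realType} (alpha : R) (U : set R) : \bar R :=
  if pselect (U !=set0) then ((fine (diam U)) `^ alpha)%:E else 0%E.

Definition hausdorff_delta {R : realType} (alpha delta : R) (A : set R) : \bar R :=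
  ereal_inf [set (\sum_(n <oo) hterm alpha (U n))%E
            | U in [set U : nat -> set R |
                     A `<=` \bigcup_n U n /\ forall n, (diam (U n) <= delta%:E)%E]].

Definition hausdorff {R : realType} (alpha : R) (A : set R) : \bar R :=
  ereal_sup [set hausdorff_delta alpha delta A | delta in `]0, +oo[%classic].

(* frame measure: nu Borel measure on R; f = g + i h ranges over L^2(mu)
   (g, h real-valued); \hat{f dmu}(t) = int f(x) e^{-2 pi i t x} dmu(x) has
   real part  int (g cos + h sin)  and imaginary part  int (h cos - g sin)
   where the angle is 2 pi t x. *)
Definition ft_re {R : realType} (mu : {measure set R -> \bar R}) (g h : R -> R) (t : R) : R :=
  Rintegral mu setT (fun x => g x * cos (2 * pi * t * x) + h x * sin (2 * pi * t * x)).
Definition ft_im {R : realType} (mu : {measure set R -> \bar R}) (g h : R -> R) (t : R) : R :=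
  Rintegral mu setT (fun x => h x * cos (2 * pi * t * x) - g x * sin (2 * pi * t * x)).

Definition is_frame_measure {R : realType} (mu nu : {measure set R -> \bar R}) : Prop :=
  exists A B : R, 0 < A /\ 0 < B /\
   forall g h : R -> R,
     measurable_fun setT g -> measurable_fun setT h ->
     (\int[mu]_x ((g x) ^+ 2)%:E < +oo)%E ->
     (\int[mu]_x ((h x) ^+ 2)%:E < +oo)%E ->
     let n2 := (\int[mu]_x ((g x) ^+ 2 + (h x) ^+ 2)%:E)%E in
     let F2 := (\int[nu]_t ((ft_re mu g h t) ^+ 2 + (ft_im mu g h t) ^+ 2)%:E)%E in
     (A%:E * n2 <= F2)%E /\ (F2 <= B%:E * n2)%E.

Definition admits_frame_measure {R : realType} (mu : {measure set R -> \bar R}) : Prop :=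
  exists nu : {measure set R -> \bar R}, is_frame_measure mu nu.

(* Main.v *)
(* The frame inequality is applied to the indicator of E and to the
   Radon-Nikodym density k of the translate of mu|_E: the two Fourier transforms
   differ by a unimodular factor, so if this translate is at most c mu then
   A mu(E) <= B int k^2 dmu <= B c mu(E), that is, c >= A / B.
   Near the fixed point of the first or of the last map, no other map contributes
   to mu, so there the n-th iterate of that map i scales mu exactly by p_i^n,
   whereas the n-th iterate of any map j scales mu by at least p_j^n.  The two
   images are translates of each other with c = (p_i / p_j)^n, and n -> oo gives
   p_j <= p_i; this proves (i).
   If alpha = 1, then mu << Lebesgue, and on some set D of positive measure the
   density lies between constants m and M.  Some translate of the image of D by
   the n-th iterate of map j meets D in positive measure, which allows
   c = (M / m) (lam / p_j)^n, whence p_j <= lam; at an end map, translating in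
   the other direction allows c = (M / m) (p_i / lam)^n, whence lam <= p_i. *)
Require Import Defs.
From HB Require Import structures.
From mathcomp Require Import all_boot all_order all_algebra.
From mathcomp Require Import all_classical all_reals all_analysis.
From mathcomp Require Import measurable_realfun ring lra.
Set Implicit Arguments. Unset Strict Implicit.
Import Order.TTheory GRing.Theory Num.Theory.
Import numFieldNormedType.Exports.
Local Open Scope classical_set_scope.
Local Open Scope ring_scope.


(** * Bounded densities and the frame inequality for translates *)

Lemma bounded_integrable d (T : measurableType d) (R : realType)
    (mu : {finite_measure set T -> \bar R}) (D : set T) (f : T -> R) (M : R) :
  measurable D -> measurable_fun setT f -> (forall x, `|f x| <= M) ->
  mu.-integrable D (EFin \o f).
Proof.
move=> mD mf fM; apply: measurable_bounded_integrable => //.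
- by rewrite ltey_eq fin_num_measure.
- exact: measurable_funTS.
- by exists M; split; [exact: num_real|move=> y My x _ /=; rewrite (le_trans (fM x))// ltW].
Qed.

(** On the set where the Radon-Nikodym density exceeds [c], the integral of the excess is
    [om P - c * mu P <= 0], so this set is [mu]-null. Truncating at [c] then makes the bound
    pointwise without changing any integral. *)
Lemma bounded_density d (T : measurableType d) (R : realType)
    (mu om : {finite_measure set T -> \bar R}) (c : R) :
  0 <= c -> (forall S, measurable S -> (om S <= c%:E * mu S)%E) ->
  exists k : T -> R, [/\ measurable_fun setT k, forall x, 0 <= k x <= c
    & forall f : T -> R, om.-integrable setT (EFin \o f) ->
        (\int[om]_x (f x)%:E = \int[mu]_x (f x * k x)%:E)%E].
Proof.
move=> c0 omc.
have ommu : om `<< mu.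
  move=> N N0 S mS SN; apply/eqP; rewrite eq_le measure_ge0 andbT.
  by rewrite (le_trans (omc _ mS))// (N0 _ mS SN) mule0.
pose g := Radon_Nikodym (charge_of_finite_measure om) mu.
pose f := Radon_Nikodym_SigmaFinite.f om mu.
have f0 x : (0 <= f x)%E by exact: Radon_Nikodym_SigmaFinite.f_ge0.
have ffin x : f x \is a fin_num by exact: Radon_Nikodym_SigmaFinite.f_fin_num.
have fint : mu.-integrable setT f by exact: Radon_Nikodym_SigmaFinite.f_integrable.
have omf S : measurable S -> om S = (\int[mu]_(x in S) f x)%E.
  by move=> mS; apply: Radon_Nikodym_SigmaFinite.f_integral.
have gint : mu.-integrable setT g by exact: Radon_Nikodym_integrable.
have mf := measurable_int _ fint.
have mg := measurable_int _ gint.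
have fg : ae_eq mu setT f g by exact: ae_eq_Radon_Nikodym_SigmaFinite.
have fc : {ae mu, forall x, (f x <= c%:E)%E}.
  pose P := [set x | (c%:E < f x)%E].
  have mP : measurable P.
    by rewrite -[P]setTI; apply: emeasurable_fun_o_infty.
  have fcP : mu.-integrable P (fun x => f x - c%:E)%E.
    apply: integrableB => //; first exact: integrableS fint.
    exact: (@finite_measure_integrable_cst _ _ _ mu P c).
  have : (\int[mu]_(x in P) `|f x - c%:E| = 0)%E.
    rewrite (eq_integral (fun x => f x - c%:E)%E); last first.
      move=> x; rewrite inE /P/= => cf; rewrite gee0_abs; [by []|idtac]; have := cf; rewrite -sube_gt0 => /ltW; exact.
    apply/eqP; rewrite eq_le; apply/andP; split; last first.
      by apply: integral_ge0 => x Px; apply: ltW; rewrite sube_gt0.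
    rewrite integralB//; [|exact: integrableS fint|].
      rewrite -omf// integral_cst// sube_le0; exact: omc.
    exact: (@finite_measure_integrable_cst _ _ _ mu P c).
  move/(ae_eq_integral_abs mu mP _).1 => /(_ (measurable_int _ fcP)).
  apply: filterS => x Px; rewrite leNgt; apply/negP => cf.
  have := Px cf => /eqP; rewrite sube_eq ?ffin// add0e => /eqP fxc.
  by move: cf; rewrite fxc ltxx.
pose k x := Num.min (fine (f x)) c.
have mk : measurable_fun setT k.
  by apply: measurable_minr => //; exact: measurableT_comp.
exists k; split=> //.
  by move=> x; rewrite le_min fine_ge0//= c0/= ge_min lexx orbT.
move=> h hint; rewrite -(Radon_Nikodym_change_of_variables ommu measurableT hint).
have mh := measurable_int _ hint.
apply: ae_eq_integral => //.
- exact: emeasurable_funM.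
- apply/measurable_EFinP; apply: measurable_funM => //; exact/measurable_EFinP.
apply: filterS2 fg fc => x /(_ I) fgx fcx _ /=.
rewrite -/g -fgx /k min_l ?EFinM ?fineK//.
by rewrite -lee_fin fineK.
Qed.

Lemma integral_mrestr d (T : measurableType d) (R : realType)
    (mu : {measure set T -> \bar R}) (D : set T) (mD : measurable D)
    (f : T -> \bar R) :
  measurable_fun setT f ->
  (\int[mrestr mu mD]_x f x = \int[mu]_(x in D) f x)%E.
Proof.
move=> mf; rewrite -(setUv D) integral_setU//; last 3 first.
- exact: measurableC.
- exact: measurable_funTS.
- exact/disj_setPCl.
rewrite [X in (_ + X)%E](_ : _ = 0)%E.
  rewrite adde0; apply: eq_measure_integral => A mA AD.
  by rewrite /= /mrestr setIidl.
apply: null_set_integral; [exact: measurableC|exact: measurable_funTS|].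
by rewrite /= /mrestr setICl measure0.
Qed.

(** The hypothesis bounds by [c mu] the push-forward, under translation by [a], of [mu] restricted
    to [E]; [k] is the density of that push-forward. *)
Lemma translate_density (R : realType) (mu : {finite_measure set R -> \bar R})
    (E : set R) (a c : R) :
  measurable E -> 0 <= c ->
  (forall S, measurable S ->
     (mu (E `&` (fun x => x + a)%R @^-1` S) <= c%:E * mu S)%E) ->
  exists k : R -> R, [/\ measurable_fun setT k, forall x, 0 <= k x <= c
    & forall (f : R -> R) (M : R), measurable_fun setT f -> (forall x, `|f x| <= M) ->
        (\int[mu]_(x in E) (f (x + a)%R)%:E = \int[mu]_x (f x * k x)%:E)%E].
Proof.
move=> mE c0 H.
have mt : measurable_fun setT (fun x : R => x + a) by exact: measurable_funD.
pose om1 := [the measure R R of pushforward (mrestr mu mE) (fun x : R => x + a)].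
pose om0 : {measure set R -> \bar R} := om1 mt.
have fom0 S : measurable S -> om0 S \is a fin_num.
  by move=> mS; apply: (@fin_num_measure _ _ _ mu); apply: measurableI => //; rewrite -[X in measurable X]setTI; exact: (mt measurableT _ mS).
pose om : {finite_measure set R -> \bar R} :=
  HB.pack (om0 : set R -> \bar R) (Measure.on om0) (Measure_isFinite.Build _ R R (om0 : set R -> \bar R) fom0).
have omE S : om S = mu (E `&` (fun x => x + a)%R @^-1` S) by rewrite setIC.
have [|k [mk kc kP]] := @bounded_density _ _ _ mu om _ c0.
  by move=> S mS; rewrite omE; exact: H.
exists k; split=> // f M mf fM.
rewrite -kP; last by apply: (@bounded_integrable _ _ _ om setT f M) => //; exact: measurableT.
apply/esym; transitivity (\int[mrestr mu mE]_(x in (fun x : R => (x + a)%R) @^-1` setT) (f (x + a)%R)%:E)%E.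
  apply: (@integral_pushforward _ _ _ _ _ _ mt (mrestr mu mE) setT (EFin \o f)) => //.
    exact/measurable_EFinP.
  apply: (@measurable_bounded_integrable _ _ _ (mrestr mu mE) (f \o (fun x : R => x + a))).
  - exact: measurableT.
  - rewrite ltey_eq preimage_setT /= /mrestr setTI; apply/orP; left; exact: (@fin_num_measure _ _ _ mu).
  - exact: measurableT_comp.
  - by exists M; split; [exact: num_real|move=> y My x _ /=; rewrite (le_trans (fM _))// ltW].
rewrite preimage_setT integral_mrestr//; apply/measurable_EFinP; exact: measurableT_comp.
Qed.
Lemma frame_translate (R : realType) (mu : {finite_measure set R -> \bar R}) :
  admits_frame_measure mu ->
  exists2 K : R, 0 < K & forall (E : set R) (a c : R),
    measurable E -> 0 <= c ->
    (forall S, measurable S ->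
      (mu (E `&` (fun x => x + a)%R @^-1` S) <= c%:E * mu S)%E) ->
    (mu E <= (K * c)%:E * mu E)%E.
Proof.
move=> [nu [A [B [A0 [B0 H]]]]]; exists (B / A); first exact: divr_gt0.
move=> E a c mE c0 Ec.
have [k [mk kc kP]] := translate_density mE c0 Ec.
have mcos (s : R) : measurable_fun setT (fun x : R => cos (s * x)).
  apply: (measurableT_comp (continuous_measurable_fun (@continuous_cos R))).
  exact: measurable_funM.
have msin (s : R) : measurable_fun setT (fun x : R => sin (s * x)).
  apply: (measurableT_comp (continuous_measurable_fun (@continuous_sin R))).
  exact: measurable_funM.
(* Both test functions are real, so their imaginary part is [z]. *)
pose z : R -> R := cst 0.
have intE (g : R -> R) (mg : measurable_fun setT g) (g1 : forall x, `|g x| <= 1) :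
    mu.-integrable E (EFin \o g).
  exact: (bounded_integrable mu (M := 1)).
have icos s : mu.-integrable E (EFin \o fun x : R => cos (s * x)).
  by apply: intE => // x; exact: cos_max.
have isin s : mu.-integrable E (EFin \o fun x : R => sin (s * x)).
  by apply: intE => // x; exact: sin_max.
pose C s := Rintegral mu E (fun x : R => cos (s * x)).
pose D s := Rintegral mu E (fun x : R => sin (s * x)).
have re1 t : ft_re mu \1_E z t = C (2 * pi * t).
  rewrite /ft_re /C [RHS]Rintegral_mkcond; apply: eq_Rintegral => x _.
  by rewrite /z/= mul0r addr0 patchE indicE; case: ifP; rewrite ?mul1r ?mul0r.
have im1 t : ft_im mu \1_E z t = - D (2 * pi * t).
  rewrite /ft_im /D [in RHS]Rintegral_mkcond -mulN1r -RintegralZl//.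
    apply: eq_Rintegral => x _.
    by rewrite /z/= mul0r sub0r patchE indicE; case: ifP; rewrite ?mul1r ?mul0r ?mulr0 ?mulN1r ?oppr0.
  by have := isin (2 * pi * t); rewrite (integrable_mkcond _ mE) restrict_EFin.
have kR (f : R -> R) : measurable_fun setT f -> (forall x, `|f x| <= 1) ->
    Rintegral mu setT (fun x => k x * f x) = Rintegral mu E (fun x => f (x + a)).
  move=> mf f1; rewrite /Rintegral (kP f 1 mf f1).
  by congr fine; apply: eq_integral => x _; rewrite mulrC.
have re2 t : ft_re mu k z t = cos (2 * pi * t * a) * C (2 * pi * t) - sin (2 * pi * t * a) * D (2 * pi * t).
  transitivity (Rintegral mu setT (fun x => k x * cos (2 * pi * t * x))).
    by apply: eq_Rintegral => x _; rewrite /z/= mul0r addr0.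
  rewrite kR//; last by move=> x; exact: cos_max.
  rewrite -!RintegralZl//  -RintegralB//.
  - by apply: eq_Rintegral => x _; rewrite mulrDr cosD mulrC [sin _ * _]mulrC.
  - exact: (@integrableZl _ _ _ mu E mE (cos (2 * pi * t * a)) _ (icos _)).
  - exact: (@integrableZl _ _ _ mu E mE (sin (2 * pi * t * a)) _ (isin _)).
have im2 t : ft_im mu k z t = - (sin (2 * pi * t * a) * C (2 * pi * t) + cos (2 * pi * t * a) * D (2 * pi * t)).
  transitivity (- Rintegral mu setT (fun x => k x * sin (2 * pi * t * x))).
    rewrite -mulN1r -RintegralZl//.
      by apply: eq_Rintegral => x _; rewrite /z/= mul0r sub0r mulN1r.
    apply: (@bounded_integrable _ _ _ _ _ _ c) => //.
      exact: measurable_funM.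
    move=> x; rewrite normrM (ger0_norm (proj1 (andP (kc x)))).
    by rewrite -[leRHS]mulr1 ler_pM// ?(proj2 (andP (kc x)))// ?(proj1 (andP (kc x)))//; exact: sin_max.
  congr (- _); rewrite kR//; last by move=> x; exact: sin_max.
  rewrite -!RintegralZl//  -RintegralD//.
  - by apply: eq_Rintegral => x _; rewrite mulrDr sinD mulrC addrC [cos _ * _]mulrC.
  - exact: (@integrableZl _ _ _ mu E mE (sin (2 * pi * t * a)) _ (icos _)).
  - exact: (@integrableZl _ _ _ mu E mE (cos (2 * pi * t * a)) _ (isin _)).
have mz : measurable_fun setT z by exact: measurable_cst.
have m1 : measurable_fun setT (\1_E : R -> R) by exact: measurable_indic.
have z2 : (\int[mu]_x ((z x) ^+ 2)%:E < +oo)%E.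
  by rewrite integral0_eq// => x _; rewrite /z/= expr0n.
have muEfin : mu E \is a fin_num by exact: fin_num_measure.
have n1 : (\int[mu]_x ((\1_E x : R) ^+ 2 + z x ^+ 2)%:E = mu E)%E.
  rewrite -[in RHS](setIT E) -(integral_indic mu measurableT mE).
  apply: eq_integral => x _; rewrite /z/= expr0n addr0 indicE.
  by case: (_ \in _); rewrite ?expr1n ?expr0n.
have i1 : (\int[mu]_x ((\1_E x : R) ^+ 2)%:E < +oo)%E.
  rewrite (_ : integral _ _ _ = mu E) ?ltey_eq ?muEfin// -n1.
  by apply: eq_integral => x _; rewrite /z/= expr0n addr0.
have mk2 : measurable_fun setT (fun x => (k x ^+ 2)%:E).
  by apply/measurable_EFinP; exact: measurable_funX.
(* From [0 <= k <= c] comes [k ^+ 2 <= c * k], and [kP] for the constant function [c] evaluates the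
   integral of [c * k] as [c * mu E]. *)
have n2 : (\int[mu]_x (k x ^+ 2)%:E <= c%:E * mu E)%E.
  apply: (@le_trans _ _ (\int[mu]_x (c * k x)%:E)%E).
    apply: ge0_le_integral => //.
    - by move=> x _; rewrite lee_fin sqr_ge0.
    - by apply/measurable_EFinP; exact: measurable_funM.
    - move=> x _; rewrite lee_fin expr2; have /andP[k0 k1] := kc x.
      exact: ler_wpM2r.
  have <- : (\int[mu]_(x in E) c%:E = c%:E * mu E)%E by rewrite integral_cst.
  by rewrite -(kP (fun _ => c) `|c|) ?lexx//; exact: measurable_cst.
have i2 : (\int[mu]_x (k x ^+ 2)%:E < +oo)%E.
  by rewrite (le_lt_trans n2)// ltey_eq fin_numM.
have [H1 _] := H _ _ m1 mz i1 z2.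
have [_ H2] := H _ _ mk mz i2 z2.
rewrite n1 in H1.
have H3 := le_trans H1 (le_trans _ H2).
have {H3} : (A%:E * mu E <= B%:E * (c%:E * mu E))%E.
  apply: le_trans (H3 _) _.
    (* The transform of [k] is that of the indicator of [E] rotated by the angle [- 2 * pi * t * a],
       so the squared moduli agree for every [t]. *)
    rewrite le_eqVlt; apply/orP; left; apply/eqP; apply: eq_integral => t _.
    congr (_%:E); rewrite re1 im1 re2 im2 !sqrrN.
    have := cos2Dsin2 (2 * pi * t * a).
    set co := cos _; set si := sin _; set c1 := C _; set d1 := D _ => csq.
    by rewrite -[LHS]mul1r -csq; ring.
  rewrite lee_pmul2l// ?lte_fin// (le_trans _ n2)//.
  rewrite le_eqVlt; apply/orP; left; apply/eqP; apply: eq_integral => t _.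
  by rewrite /z/= expr0n addr0.
move=> H3; rewrite -(@lee_pmul2l _ A%:E) ?lte_fin// (le_trans H3)//.
rewrite !muleA -!EFinM; apply: lee_wpmul2r; first exact: measure_ge0.
by rewrite lee_fin; rewrite mulrA mulrCA divff ?mulr1 ?gt_eqF// mulrC.
Qed.

(** * Lebesgue measure under affine maps and translations *)

(* [lebesgue_measure] lives on [measurableTypeR R]; this is the same set function
   on the Borel space [R] that carries [mu]. *)
Definition leb {R : realType} : set R -> \bar R := @lebesgue_measure R.
HB.instance Definition _ (R : realType) := isMeasure.Build _ R R (@leb R)
  (measure0 (@lebesgue_measure R)) (measure_ge0 (@lebesgue_measure R))
  (@measure_semi_sigma_additive _ _ _ (@lebesgue_measure R)).
HB.instance Definition _ (R : realType) := Measure_isSigmaFinite.Build _ R R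
  (@leb R) (@sigma_finiteT _ _ _ (@lebesgue_measure R)).

Lemma leb_itv_oc (R : realType) (a b : R) : a <= b ->
  leb `]a, b]%classic = (b - a)%:E.
Proof.
move=> ab; rewrite /leb lebesgue_measure_itv/= lte_fin.
by case: ltP => // ba; rewrite (@le_anti _ _ a b) ?ab ?ba// subrr.
Qed.

Lemma leb_unique (R : realType) (m : {measure set R -> \bar R}) :
    (forall a b : R, a <= b -> m `]a, b]%classic = (b - a)%:E) ->
  forall A, measurable A -> leb A = m A.
Proof.
move=> H A mA.
pose m' : set (measurableTypeR R) -> \bar R := m.
pose hm := isMeasure.Build _ (measurableTypeR R) R m' (measure0 m) (measure_ge0 m) (@measure_semi_sigma_additive _ _ _ m).
pose M : {measure set (measurableTypeR R) -> \bar R} := HB.pack m' hm.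
apply: (@lebesgue_measure_unique R M) => // _ [[a b]] _ <-/=.
change (leb `]a, b]%classic = m `]a, b]%classic).
have [ab|ba] := leP a b; first by rewrite leb_itv_oc// H.
by rewrite set_itv_ge ?measure0// bnd_simp -leNgt ltW.
Qed.

Lemma measurable_affine (R : realType) (c d : R) :
  measurable_fun setT (fun x : R => c * x + d).
Proof. by apply: measurable_funD => //; exact: measurable_funM. Qed.

Lemma measurable_affine_preimage (R : realType) (c d : R) (S : set R) :
  measurable S -> measurable ((fun x : R => c * x + d) @^-1` S).
Proof. by move=> mS; rewrite -[X in measurable X]setTI; exact: measurable_affine. Qed.

(** The push-forward of [leb] under the affine map, scaled by [c], gives every half-open interval
    its length, hence is Lebesgue measure. *)
Lemma leb_affine (R : realType) (c d : R) (S : set R) :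
  0 < c -> measurable S ->
  leb S = (c%:E * leb ((fun x => c * x + d)%R @^-1` S))%E.
Proof.
move=> c0 mS; have mt := @measurable_affine R c d.
pose m1 := [the measure R R of pushforward (@leb R) (fun x : R => c * x + d)].
pose m := mscale (NngNum (ltW c0)) (m1 mt).
rewrite (@leb_unique R [the measure R R of m]) => // a b ab.
rewrite /= /m/= /mscale/= /m1/= /pushforward.
rewrite (_ : _ @^-1` _ = `](a - d) / c, (b - d) / c]%classic).
  rewrite leb_itv_oc; last by rewrite ler_pM2r ?invr_gt0// lerB.
  by rewrite -EFinM -mulrBl mulrCA divff ?gt_eqF// mulr1 opprB addrA subrK.
apply/seteqP; split=> x/=; rewrite !in_itv/= ltr_pdivrMr// ler_pdivlMr// ltrBlDr lerBrDr (mulrC x)//.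
Qed.

Lemma leb_translate (R : realType) (a : R) (S : set R) : measurable S ->
  leb ((fun x => x + a)%R @^-1` S) = leb S.
Proof.
move=> mS; rewrite [RHS](@leb_affine _ 1 a _ ltr01 mS) mul1e; congr leb.
by apply/seteqP; split=> x /=; rewrite mul1r.
Qed.

(** By Tonelli, integrating the measure of this intersection over all [a] yields [leb P * leb Q], so
    the intersections cannot all be null. *)
Lemma exists_translate_meet (R : realType) (P Q : set R) :
  measurable P -> measurable Q -> (0 < leb P)%E -> (0 < leb Q)%E ->
  exists a : R, (0 < leb (P `&` (fun x => x + a)%R @^-1` Q))%E.
Proof.
move=> mP mQ P0 Q0; apply: contrapT => /forallNP H.
have H0 a : leb (P `&` (fun x => x + a)%R @^-1` Q) = 0%E.
  by apply/eqP; rewrite eq_le measure_ge0 andbT leNgt; exact/negP/H.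
pose f (z : R * R) : \bar R := ((\1_P z.1 : R) * \1_Q (z.1 + z.2))%:E.
have mf : measurable_fun setT f.
  apply/measurable_EFinP/measurable_funM.
    exact: (measurableT_comp (measurable_indic mP) measurable_fst).
  apply: (measurableT_comp (measurable_indic mQ)).
  by apply: measurable_funD; [exact: measurable_fst|exact: measurable_snd].
have f0 z : (0 <= f z)%E by rewrite lee_fin mulr_ge0// indicE.
have := @fubini_tonelli _ _ R R R leb leb f mf f0.
have mQa (a : R) : measurable ((fun x : R => x + a) @^-1` Q).
  by rewrite -[X in measurable X]setTI; apply: measurable_funD.
rewrite [RHS](_ : _ = 0)%E; last first.
  apply: integral0_eq => y _; rewrite -[RHS](H0 y) -[in RHS](setIT (P `&` _)).
  rewrite -(integral_indic leb measurableT)//; last exact: measurableI.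
  by apply: eq_integral => x _; rewrite /f/= indicI.
rewrite (eq_integral (fun x => leb Q * (\1_P x)%:E)%E); last first.
  move=> x _; have [xP|xP] := boolP (x \in P).
    rewrite indicE xP mule1 -(leb_translate x mQ) -[in RHS](setIT (_ @^-1` Q)).
    rewrite -(integral_indic leb measurableT)//.
    by apply: eq_integral => y _; rewrite /f/= indicE xP mul1r addrC.
  rewrite indicE (negbTE xP) mule0; apply: integral0_eq => y _.
  by rewrite /f/= indicE (negbTE xP) mul0r.
rewrite ge0_integralZl//; last by apply/measurable_EFinP; exact: measurable_indic.
rewrite integral_indic// setIT => /eqP; rewrite mule_eq0.
by rewrite !gt_eqF.
Qed.

(** * One-dimensional Hausdorff measure of Lebesgue null sets *)

Lemma hterm_ge0 (R : realType) (alpha : R) (U : set R) : (0 <= hterm alpha U)%E.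
Proof. by rewrite /hterm; case: pselect => [?|?]; rewrite lee_fin ?powR_ge0. Qed.

Lemma hausdorff_eq0 (R : realType) (alpha : R) (A : set R) :
  (forall delta : R, 0 < delta -> (hausdorff_delta alpha delta A <= 0)%E) ->
  hausdorff alpha A = 0%E.
Proof.
move=> H; apply/eqP; rewrite eq_le; apply/andP; split.
  by apply: ge_ereal_sup => _ [delta /= + <-]; rewrite in_itv/= andbT => /H.
apply: (@le_trans _ _ (hausdorff_delta alpha 1 A)).
  apply: le_ereal_inf_tmp => _ [U _ <-].
  by apply: nneseries_ge0 => n _ _; exact: hterm_ge0.
by apply: ereal_sup_ubound; exists 1 => //=; rewrite in_itv/= ltr01.
Qed.

Lemma hausdorff_set0 (R : realType) (alpha : R) :
  hausdorff alpha (set0 : set R) = 0%E.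
Proof.
apply: hausdorff_eq0 => delta _; apply: ereal_inf_lbound.
exists (fun _ => set0).
  (* The empty set has diameter [-oo], so the cover by empty sets is admissible for every
     [delta]. *)
  split=> // n; rewrite /diam [X in ereal_sup X](_ : _ = set0) ?ereal_sup0 ?leNye//.
  by apply/seteqP; split=> x // [? []].
by apply: eseries0 => n _ _; rewrite /hterm; case: pselect => [[]|].
Qed.

Lemma diam_ocitv (R : realType) (I : set R) : ocitv I ->
  (diam I <= wlength (@idfun R) I)%E.
Proof.
move=> [[a b] _ <-]; apply: ge_ereal_sup => _ [x + [y + <-]].
rewrite /= !in_itv/= => /andP[ax xb] /andP[ay yb].
rewrite wlength_itv/= lte_fin (lt_le_trans ax xb) -EFinB lee_fin ler_norml.
by apply/andP; split; lra.
Qed.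

Lemma hterm1_ocitv (R : realType) (I : set R) : ocitv I ->
  (hterm 1 I <= wlength (@idfun R) I)%E.
Proof.
move=> Io; rewrite /hterm; case: pselect => [[x Ix]|?]; last first.
  by apply: wlength_ge0.
have d0 : (0 <= diam I)%E.
  by apply: ereal_sup_ubound; exists x => //; exists x => //; rewrite subrr normr0.
have dI := diam_ocitv Io.
have dfin : diam I \is a fin_num.
  rewrite ge0_fin_numE// (le_lt_trans dI)//.
  by case: Io => [[a b] _ <-]; rewrite wlength_itv/=; case: ifP => _; rewrite ?ltry.
by rewrite powRr1 ?fine_ge0// fineK.
Qed.

(** A null set has covers by half-open intervals of total length below [min(delta, e)]. The bound by
    [delta] makes each interval short enough to be admissible; the bound by [e] controls the sum. *)
Lemma hausdorff1_leb0 (R : realType) (E X : set R) :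
  leb E = 0%E -> hausdorff 1 (E `&` X) = 0%E.
Proof.
move=> E0; apply: hausdorff_eq0 => delta d0; apply/lee_addgt0Pr => e e0.
pose r := Num.min delta e.
have r0 : 0 < r by rewrite lt_min d0.
have : (mu_ext (wlength (@idfun R)) E < r%:E)%E.
  by change (leb E < r%:E)%E; rewrite E0 lte_fin.
rewrite /mu_ext => /ereal_inf_lt [_ [A [mA EA] <-]] Ar.
have wge0 k : (0 <= wlength (@idfun R) (A k))%E by exact: wlength_ge0.
rewrite add0e; apply: (@le_trans _ _ (\sum_(k <oo) hterm 1 (A k))%E).
  apply: ereal_inf_lbound; exists A => //; split.
    by move=> x [Ex _]; exact: EA.
  move=> n; apply: (le_trans (diam_ocitv (mA n))).
  apply: (@le_trans _ _ r%:E); last by rewrite lee_fin ge_min lexx.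
  (* A single length is at most the total: it is the last of the first [n.+1] terms, and all other
     terms are nonnegative. *)
  apply: le_trans (ltW Ar); rewrite (nneseries_split 0 n.+1)// add0n.
  rewrite big_nat_recr//= -addeA addeCA leeDl// adde_ge0 ?sume_ge0 ?nneseries_ge0//.
apply: (@le_trans _ _ r%:E); last by rewrite lee_fin ge_min lexx orbT.
apply: le_trans (ltW Ar); apply: lee_nneseries => n *; [exact: hterm_ge0|exact/hterm1_ocitv/mA].
Qed.

(** * Geometric sequences and iterates of the contractions *)

(** This is the passage [n -> oo] in every comparison of weights: if [q < 1], then [K * q ^+ n]
    tends to 0. *)
Lemma geometric_bounded_below (R : realType) (K q : R) :
  0 <= q -> (forall n, 1 <= K * q ^+ n) -> 1 <= q.
Proof.
move=> q0 Kq; rewrite leNgt; apply/negP => q1.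
have : geometric K q @ \oo --> 0 by apply: cvg_geometric; rewrite ger0_norm.
move/cvgrPdist_lt => /(_ 1 ltr01) [n _ /(_ n (leqnn n))].
by rewrite sub0r normrN => /(le_lt_trans (ler_norm _)); rewrite ltNge Kq.
Qed.

Lemma exists_expr_lt (R : realType) (q e : R) : 0 <= q -> q < 1 -> 0 < e ->
  exists n, q ^+ n < e.
Proof.
move=> q0 q1 e0; apply: contrapT => /forallNP H.
suff : 1 <= q by rewrite leNgt q1.
apply: (@geometric_bounded_below _ e^-1) => // n.
by rewrite mulrC ler_pdivlMr// mul1r leNgt; exact/negP/H.
Qed.

(** The linear part does not depend on [b], so [n]-th iterates of two different maps differ by a
    translation. *)
Lemma iter_tauE (R : realType) (lam b : R) n (x : R) :
  iter n (tau lam b) x = lam ^+ n * x + iter n (tau lam b) 0.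
Proof.
elim: n x => [|n IH] x; first by rewrite /= expr0 mul1r addr0.
by rewrite !iterS IH /tau exprS; ring.
Qed.

Lemma iter_tau_inj (R : realType) (lam b : R) n : lam != 0 ->
  injective (iter n (tau lam b)).
Proof.
move=> l0 x y; rewrite (iter_tauE _ _ _ x) (iter_tauE _ _ _ y) => /addIr.
by apply: mulfI; rewrite expf_neq0.
Qed.

Lemma measurable_preimage_iter_tau (R : realType) (lam b : R) n (S : set R) :
  measurable S -> measurable (iter n (tau lam b) @^-1` S).
Proof.
move=> mS; rewrite (_ : iter n _ = fun x => lam ^+ n * x + iter n (tau lam b) 0).
  exact: measurable_affine_preimage.
by apply/funext => x; exact: iter_tauE.
Qed.

Lemma measurable_image_iter_tau (R : realType) (lam b : R) n (S : set R) :
  lam != 0 -> measurable S -> measurable (iter n (tau lam b) @` S).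
Proof.
move=> l0 mS; pose c := iter n (tau lam b) 0.
have ln0 : lam ^+ n != 0 by rewrite expf_neq0.
rewrite (_ : _ @` S = (fun x => (lam ^+ n)^-1 * x + - c / lam ^+ n) @^-1` S).
  exact: measurable_affine_preimage.
apply/seteqP; split=> [_ [x Sx <-]|x Sx] /=.
  by rewrite iter_tauE -/c (_ : _ + _ = x)//; field.
by exists ((lam ^+ n)^-1 * x + - c / lam ^+ n) => //; rewrite iter_tauE -/c; field.
Qed.

Lemma leb_preimage_iter_tau (R : realType) (lam b : R) n (S : set R) :
  0 < lam -> measurable S ->
  leb S = ((lam ^+ n)%:E * leb (iter n (tau lam b) @^-1` S))%E.
Proof.
move=> l0 mS; rewrite (leb_affine (iter n (tau lam b) 0) (exprn_gt0 n l0) mS).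
by congr (_ * leb _)%E; apply/funext => x /=; rewrite [in RHS]iter_tauE.
Qed.

(** * Sets of bounded density, and the location of the attractor *)

Lemma density_bounds (R : realType) (mu : {finite_measure set R -> \bar R})
    (U : set R) :
  mu `<< leb -> measurable U -> (0 < mu U)%E ->
  exists (D : set R) (m M : R), [/\ measurable D, D `<=` U, (0 < mu D)%E,
    0 < m & 0 < M /\ forall S, measurable S -> S `<=` D ->
      (m%:E * leb S <= mu S)%E /\ (mu S <= M%:E * leb S)%E].
Proof.
move=> mul mU U0; have [f [f0 ffin fint fE]] := radon_nikodym_sigma_finite mul.
have mf := measurable_int _ fint.
pose D k := U `&` ([set x | (k.+1%:R^-1%:E <= f x)%E] `&` [set x | (f x <= k.+1%:R%:E)%E]).
have mD k : measurable (D k).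
  apply: measurableI => //; apply: measurableI; rewrite -[X in measurable X]setTI.
    exact: emeasurable_fun_c_infty.
  exact: emeasurable_fun_infty_c.
(* Otherwise [U] would be null, being covered by the sets [D k] and the set [Z] on which the density
   vanishes. *)
have [k Dk0] : exists k, (0 < mu (D k))%E.
  apply: contrapT => /forallNP H.
  have D0 k : mu (D k) = 0%E.
    by apply/eqP; rewrite eq_le measure_ge0 andbT leNgt; exact/negP/H.
  pose Z := U `&` [set x | (f x <= 0)%E].
  have mZ : measurable Z.
    apply: measurableI => //; rewrite -[X in measurable X]setTI.
    exact: emeasurable_fun_infty_c.
  have Z0 : mu Z = 0%E.
    rewrite fE//; apply: integral0_eq => x [_ /= fx].
    by apply/eqP; rewrite eq_le fx f0.
  have mUD : measurable (\bigcup_k D k) by exact: bigcup_measurable.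
  have UD0 : mu (\bigcup_k D k) = 0%E.
    apply/eqP; rewrite -measure_le0.
    apply: (le_trans (measure_sigma_subadditive mu mD mUD (@subset_refl _ _))).
    by rewrite eseries0// => k _ _; exact: D0.
  suff : (mu U <= 0)%E by rewrite leNgt U0.
  apply: (@le_trans _ _ (mu (Z `|` \bigcup_k D k))); last first.
    apply: (le_trans (measureU2 mu mZ mUD)); rewrite -[leRHS]adde0.
    by apply: leeD; [rewrite -Z0|rewrite -UD0].
  apply: le_measure; rewrite ?inE//; first exact: measurableU.
  move=> x Ux; have [fx|fx] := leP (f x) 0%E; first by left.
  right; have := ffin x; case fxE: (f x) (fx) => [r| |]// r0 _; rewrite lte_fin in r0.
  (* With this choice [k.+1] exceeds both [r] and [r^-1]. *)
  pose k := Num.truncn (r + r^-1); exists k => //.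
  have kr : r + r^-1 < k.+1%:R by exact: truncnS_gt.
  have ri : 0 < r^-1 by rewrite invr_gt0.
  split=> //; split; rewrite /= fxE lee_fin.
    rewrite -[leRHS]invrK lef_pV2 ?posrE//; apply: ltW; apply: lt_trans kr.
    by rewrite ltrDr.
  by apply: ltW; apply: lt_trans kr; rewrite ltrDl.
exists (D k), k.+1%:R^-1, k.+1%:R; split=> //.
- by move=> x [].
split=> // S mS SD; rewrite fE// -!integral_cst//.
split; apply: ge0_le_integral => //.
- by move=> x _; rewrite lee_fin invr_ge0.
- exact: measurable_funTS.
- by move=> x /SD [_ []].
- exact: measurable_funTS.
- by move=> x /SD [_ []].
Qed.

(** Every point of [X] is [lam * y + c] with [y] in [X] and [0 <= c <= 1 - lam]. Hence
    [sup X <= lam * sup X + (1 - lam)] and [lam * inf X <= inf X], which give [sup X <= 1] and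
    [0 <= inf X]. *)
Lemma attractor_itv (R : realType) (lam : R) (N : nat) (b : nat -> R) (X : set R) :
  0 < lam -> lam < 1 ->
  (forall i, (i < N)%N -> 0 <= b i <= 1 - lam) ->
  X !=set0 -> compact X ->
  X = \bigcup_(i in [set i | (i < N)%N]) (tau lam (b i) @` X) ->
  X `<=` `[0, 1]%classic.
Proof.
move=> l0 l1 b01 X0 cX XE.
have [M [_ MX]] := compact_bounded cX.
have XM x : X x -> `|x| <= M + 1 by apply: MX; rewrite ltrDl.
have Xpre x : X x -> exists2 y, X y & exists2 c, 0 <= c <= 1 - lam & x = lam * y + c.
  by rewrite {1}XE => -[i iN [y Xy <-]]; exists y => //; exists (b i); [exact: b01|].
have hs : has_sup X.
  by split=> //; exists (M + 1) => x /XM /(le_trans (ler_norm _)).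
have hi : has_inf X.
  by split=> //; exists (- (M + 1)) => x /XM; rewrite ler_norml => /andP[].
have s1 : sup X <= 1.
  have : sup X <= lam * sup X + (1 - lam).
    apply: ge_sup => // x /Xpre [y Xy [c /andP[_ c1] ->]].
    by rewrite lerD// ler_pM2l//; apply: sup_upper_bound.
  by rewrite -lerBlDl -{1}[sup X]mul1r -mulrBl -{2}[1 - lam]mulr1 ler_pM2l// subr_gt0.
have i0 : 0 <= inf X.
  have : lam * inf X <= inf X.
    apply: lb_le_inf => // x /Xpre [y Xy [c /andP[c0 _] ->]].
    by rewrite -[leLHS]addr0 lerD// ler_pM2l//; apply: inf_lbound => //; case: hi.
  by rewrite -subr_ge0 -{1}[inf X]mul1r -mulrBl pmulr_rge0// subr_gt0.
move=> x Xx; rewrite /= in_itv/=; apply/andP; split.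
  by apply: (le_trans i0); apply: inf_lbound => //; case: hi.
by apply: le_trans s1; apply: sup_upper_bound.
Qed.

(** * Weight inequalities for self-similar measures *)

Section self_similar.
Context {R : realType} (lam : R) (N : nat) (b p : nat -> R).
Context (mu : {finite_measure set R -> \bar R}).
Hypothesis lam_gt0 : 0 < lam.
Hypothesis p_gt0 : forall i, (i < N)%N -> 0 < p i.
Hypothesis muE : forall E, measurable E ->
  mu E = (\sum_(i < N) (p i)%:E * mu (tau lam (b i) @^-1` E))%E.

Let lam_neq0 : lam != 0. Proof. by rewrite gt_eqF. Qed.

Let measurable_tau i (S : set R) : measurable S ->
  measurable (tau lam (b i) @^-1` S).
Proof. exact: (@measurable_preimage_iter_tau _ lam (b i) 1). Qed.

(** All terms of [muE] except the [j]-th are dropped, [n] times in succession. *)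
Lemma self_similar_ge j n (S : set R) : (j < N)%N -> measurable S ->
  ((p j ^+ n)%:E * mu (iter n (tau lam (b j)) @^-1` S) <= mu S)%E.
Proof.
move=> jN; elim: n S => [|n IH] S mS; first by rewrite expr0 mul1e.
have mS' := measurable_tau j mS.
rewrite (muE mS) (bigD1 (Ordinal jN))//=.
rewrite -[leLHS]adde0; apply: leeD; last first.
  by apply: sume_ge0 => i _; apply: mule_ge0; [rewrite lee_fin ltW ?p_gt0|exact: measure_ge0].
rewrite exprS EFinM -muleA; apply: lee_wpmul2l; first by rewrite lee_fin ltW ?p_gt0.
exact: (IH _ mS').
Qed.

(* On the part of [0, 1] inside [U] only the [i]-th map contributes, so the sum
   in [muE] reduces to its [i]-th term. *)
Lemma self_similar_end i n (U S : set R) : (i < N)%N ->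
  mu (~` `[0, 1]%classic) = 0%E ->
  (forall j x, (j < N)%N -> j != i -> 0 <= x <= 1 -> ~ U (tau lam (b j) x)) ->
  (forall x, U x -> U (tau lam (b i) x)) ->
  measurable S -> S `<=` iter n (tau lam (b i)) @` U ->
  (mu S <= (p i ^+ n)%:E * mu (iter n (tau lam (b i)) @^-1` S))%E.
Proof.
move=> iN mu0 Uj Ui; elim: n S => [|n IH] S mS SU; first by rewrite expr0 mul1e.
have Ui_iter m x : U x -> U (iter m (tau lam (b i)) x).
  by move=> Ux; elim: m => //= m; exact: Ui.
rewrite (muE mS) (bigD1 (Ordinal iN))//= big1 ?adde0; last first.
  move=> j ji; apply/eqP; rewrite mule_eq0; apply/orP; right.
  rewrite -measure_le0 -mu0; apply: le_measure; rewrite ?inE.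
  - exact: measurable_tau.
  - exact: measurableC.
  - move=> x /SU [y Uy yx]; rewrite /= in_itv/= => x01.
    by apply: (@Uj j x) => //; rewrite -yx; exact: Ui_iter.
rewrite exprS EFinM -muleA; apply: lee_wpmul2l; first by rewrite lee_fin ltW ?p_gt0.
apply: IH; first exact: measurable_tau.
move=> x /SU [y Uy] /= yx; exists y => //.
exact: (@iter_tau_inj _ lam (b i) 1).
Qed.

(** This is the reverse of [self_similar_ge], so inside these images the scaling by [p i ^+ n] is
    exact. It lets the first and the last map be treated alike. *)
Definition is_end_map i (U : set R) :=
  forall n S, measurable S -> S `<=` iter n (tau lam (b i)) @` U ->
    (mu S <= (p i ^+ n)%:E * mu (iter n (tau lam (b i)) @^-1` S))%E.

Lemma frame_translate_ge1 : admits_frame_measure mu ->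
  exists K : R, forall (E : set R) (a c : R),
    measurable E -> (0 < mu E)%E -> 0 <= c ->
    (forall S, measurable S ->
      (mu (E `&` (fun x => x + a)%R @^-1` S) <= c%:E * mu S)%E) ->
    1 <= K * c.
Proof.
move=> /frame_translate[K _ HK]; exists K => E a c mE E0 c0 /(HK _ _ _ mE c0).
by rewrite -[leLHS]mul1e lee_pmul2r ?fin_num_measure// lee_fin.
Qed.

Lemma frame_weight_le i j (U : set R) : (i < N)%N -> (j < N)%N ->
  measurable U -> (0 < mu U)%E -> is_end_map i U ->
  admits_frame_measure mu -> p j <= p i.
Proof.
move=> iN jN mU U0 endi /frame_translate_ge1[K HK].
have pi0 := p_gt0 iN; have pj0 := p_gt0 jN.
rewrite -[p j]mul1r -ler_pdivlMr//.
apply: (@geometric_bounded_below _ K); first by rewrite divr_ge0 ?ltW.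
move=> n; pose E := iter n (tau lam (b i)) @` U.
have mE : measurable E by exact: measurable_image_iter_tau.
(* Translation by [a] turns the [n]-th iterate of map [i] into that of map [j]. *)
pose a := iter n (tau lam (b j)) 0 - iter n (tau lam (b i)) 0.
have E0 : (0 < mu E)%E.
  apply: lt_le_trans (self_similar_ge n iN mE).
  rewrite mule_gt0 ?lte_fin ?exprn_gt0//; apply: (lt_le_trans U0).
  apply: le_measure; rewrite ?inE//; first exact: measurable_preimage_iter_tau.
  by move=> x Ux /=; exists x.
apply: (HK E a) => //; first by rewrite exprn_ge0// divr_ge0 ?ltW.
move=> S mS; set S' := E `&` _.
  have mS' : measurable S'.
    by apply: measurableI => //; rewrite -[X in measurable X]setTI; apply: measurable_funD.
  apply: (le_trans (endi n S' mS' _)); first by move=> x [].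
  rewrite expr_div_n EFinM -muleA; apply: lee_wpmul2l; first by rewrite lee_fin exprn_ge0 ?ltW.
  rewrite -(@lee_pmul2l _ (p j ^+ n)%:E) ?lte_fin ?exprn_gt0// muleA -EFinM divff ?mul1e ?expf_neq0 ?gt_eqF//.
  apply: le_trans (self_similar_ge n jN mS).
  apply: lee_wpmul2l; first by rewrite lee_fin exprn_ge0 ?ltW.
  apply: le_measure; rewrite ?inE//; try exact: measurable_preimage_iter_tau.
  move=> x [_] /=; rewrite iter_tauE /a [in X in _ -> X]iter_tauE.
  by rewrite -addrA [X in _ + X]addrC subrK.
Qed.

Definition density_between (D : set R) (m M : R) :=
  forall S, measurable S -> S `<=` D ->
    (m%:E * leb S <= mu S)%E /\ (mu S <= M%:E * leb S)%E.

Section density.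
Context (D : set R) (m M : R).
Hypotheses (mD : measurable D) (D_gt0 : (0 < mu D)%E).
Hypotheses (m_gt0 : 0 < m) (M_gt0 : 0 < M) (D_density : density_between D m M).

Let lebD_gt0 : (0 < leb D)%E.
Proof.
rewrite lt_neqAle measure_ge0 andbT eq_sym; apply/eqP => D0.
have [_] := D_density mD (@subset_refl _ _).
by rewrite D0 mule0 leNgt D_gt0.
Qed.

Let image n i := iter n (tau lam (b i)) @` D.

Let measurable_image n i : measurable (image n i).
Proof. exact: measurable_image_iter_tau. Qed.

Let leb_image_gt0 n i : (0 < leb (image n i))%E.
Proof.
rewrite (leb_preimage_iter_tau (b i) n lam_gt0 (measurable_image n i)).
rewrite mule_gt0 ?lte_fin ?exprn_gt0//; apply: (lt_le_trans lebD_gt0).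
apply: le_measure; rewrite ?inE//; first exact: measurable_preimage_iter_tau.
by move=> x Dx; exists x.
Qed.

Let preimage_image n i (S : set R) : S `<=` image n i ->
  iter n (tau lam (b i)) @^-1` S `<=` D.
Proof.
by move=> SD x /SD [y Dy] /(iter_tau_inj lam_neq0) <-.
Qed.

Let measurable_translate a (S : set R) : measurable S ->
  measurable ((fun x => x + a)%R @^-1` S).
Proof. by move=> mS; rewrite -[X in measurable X]setTI; apply: measurable_funD. Qed.

(** The measure of a part of [D] is compared with [leb], moved into the [j]-th image, and pulled
    back by the iterate, which gives the factor [lam ^+ n]. The pull-back lies in [D] again, where
    [m] returns to [mu]; [self_similar_ge] then costs [p j ^- n]. *)
Lemma frame_weight_le_ratio j : (j < N)%N -> admits_frame_measure mu ->
  p j <= lam.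
Proof.
move=> jN /frame_translate_ge1[K HK]; have pj0 := p_gt0 jN.
rewrite -[p j]mul1r -ler_pdivlMr//.
apply: (@geometric_bounded_below _ (K * (M / m))); first by rewrite divr_ge0 ?ltW.
move=> n; pose F := image n j.
(* The translation [a] varies with [n], but the frame constant [K] does not. *)
have [a aE] := exists_translate_meet mD (measurable_image n j) lebD_gt0 (leb_image_gt0 n j).
have mE := measurableI _ _ mD (measurable_translate a (measurable_image n j)).
rewrite -mulrA; apply: (HK _ a _ mE).
- have [+ _] := D_density mE (@subIsetl _ _ _).
  by apply: lt_le_trans; rewrite mule_gt0.
- by rewrite mulr_ge0 ?exprn_ge0 ?divr_ge0 ?ltW.
move=> S mS; set E' := _ `&` _.
have mE' : measurable E' by apply: measurableI => //; exact: measurable_translate.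
have mFS : measurable (F `&` S) by apply: measurableI => //; exact: measurable_image.
have mG := measurable_preimage_iter_tau lam (b j) n mFS.
have GD := preimage_image (@subIsetl _ F S).
have [_ EM] := D_density mE' (fun x H => H.1.1).
apply: (le_trans EM).
rewrite -mulrA EFinM -muleA; apply: lee_wpmul2l; first by rewrite lee_fin ltW.
apply: (@le_trans _ _ (leb (F `&` S))).
  rewrite -(leb_translate a mFS); apply: le_measure; rewrite ?inE//.
    exact: measurable_translate.
  by move=> x [[_ ?] ?]; split.
rewrite (leb_preimage_iter_tau (b j) n lam_gt0 mFS) EFinM -muleA lee_pdivlMl// muleCA.
rewrite expr_div_n EFinM -muleA; apply: lee_wpmul2l; first by rewrite lee_fin exprn_ge0 ?ltW.
rewrite lee_pdivlMl ?exprn_gt0//.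
apply: (@le_trans _ _ (mu (F `&` S))); last first.
  by apply: le_measure; rewrite ?inE//; exact: subIsetr.
apply: le_trans (self_similar_ge n jN mFS).
apply: lee_wpmul2l; first by rewrite lee_fin exprn_ge0 ?ltW.
by have [] := D_density mG GD.
Qed.

(** Here the end image is moved into [D]. Since [D] lies in [U], the end estimate bounds [mu] on
    that image from above by [p i ^+ n] times its pull-back, and passing to [leb] and back up costs
    [lam ^- n]. *)
Lemma frame_weight_ge_ratio i (U : set R) : (i < N)%N -> D `<=` U ->
  is_end_map i U -> admits_frame_measure mu -> lam <= p i.
Proof.
move=> iN DU endi /frame_translate_ge1[K HK]; have pi0 := p_gt0 iN.
rewrite -[lam]mul1r -ler_pdivlMr//.
apply: (@geometric_bounded_below _ (K * (M / m))); first by rewrite divr_ge0 ?ltW.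
move=> n; pose F := image n i.
have [a aE] := exists_translate_meet (measurable_image n i) mD (leb_image_gt0 n i) lebD_gt0.
have mE := measurableI _ _ (measurable_image n i) (measurable_translate a mD).
have ln0 : lam ^+ n != 0 by rewrite gt_eqF// exprn_gt0.
rewrite -mulrA; apply: (HK _ a _ mE).
- apply: lt_le_trans (self_similar_ge n iN mE).
  rewrite mule_gt0 ?lte_fin ?exprn_gt0//.
  have [+ _] := D_density (measurable_preimage_iter_tau lam (b i) n mE) (preimage_image (@subIsetl _ _ _)).
  apply: lt_le_trans; rewrite mule_gt0//.
  by move: aE; rewrite (leb_preimage_iter_tau (b i) n lam_gt0 mE) pmule_rgt0// lte_fin exprn_gt0.
- by rewrite mulr_ge0 ?exprn_ge0 ?divr_ge0 ?ltW.
move=> S mS; set E' := _ `&` _.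
have mE' : measurable E' by apply: measurableI => //; exact: measurable_translate.
have mDS : measurable (D `&` S) by exact: measurableI.
apply: (le_trans (endi n E' mE' _)).
  by move=> x [[[y Dy <-] _] _]; exists y => //; exact: DU.
have mG := measurable_preimage_iter_tau lam (b i) n mE'.
have E'F : E' `<=` F by move=> x [[]].
have [_ GM] := D_density mG (preimage_image E'F).
apply: (@le_trans _ _ ((p i ^+ n)%:E * (M%:E * leb (iter n (tau lam (b i)) @^-1` E')))%E).
  by apply: lee_wpmul2l => //; rewrite lee_fin exprn_ge0 ?ltW.
(* The factors [m] and [lam ^+ n] are inserted so that [lam ^+ n * x] becomes [leb E'], and
   [m * leb] is then bounded by [mu] inside [D]. *)
set x := leb _; rewrite [leLHS](_ : _ = ((M / m * (p i / lam) ^+ n)%:E * (m%:E * ((lam ^+ n)%:E * x)))%E); last first.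
  rewrite !muleA -!EFinM; congr (_%:E * _)%E.
  by rewrite expr_div_n; field; rewrite ln0 gt_eqF.
apply: lee_wpmul2l; first by rewrite lee_fin mulr_ge0 ?exprn_ge0 ?divr_ge0 ?ltW.
rewrite -(leb_preimage_iter_tau (b i) n lam_gt0 mE').
apply: (@le_trans _ _ (m%:E * leb (D `&` S))%E).
  apply: lee_wpmul2l; first by rewrite lee_fin ltW.
  rewrite -(leb_translate a mDS); apply: le_measure; rewrite ?inE//.
    exact: measurable_translate.
  by move=> y [[_ ?] ?]; split.
have [+ _] := D_density mDS (@subIsetl _ _ _).
move=> /le_trans; apply; apply: le_measure; rewrite ?inE//; exact: subIsetr.
Qed.

End density.
End self_similar.

(** * The two end maps and the conclusion *)

(* Indices 1..N of the paper are 0..N-1 here. *)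
Theorem theorem4p1 (R : realType) (lam : R) (N : nat) (b p : nat -> R)
  (X : set R) (mu : probability R R) (alpha : R) :
  0 < lam -> lam < 1 ->
  b 0%N = 0 -> b N.-1 = 1 - lam ->
  (forall i, (i.+1 < N)%N -> b i < b i.+1) ->
  (forall i, (i < N)%N -> 0 < p i) ->
  \sum_(i < N) p i = 1 ->
  (* X is the attractor *)
  X !=set0 -> compact X ->
  X = \bigcup_(i in [set i | (i < N)%N]) (tau lam (b i) @` X) ->
  (* mu is the self-similar measure *)
  (forall E, measurable E ->
     mu E = (\sum_(i < N) (p i)%:E * mu (tau lam (b i) @^-1` E))%E) ->
  0 <= alpha ->
  (0 < hausdorff alpha X)%E -> (hausdorff alpha X < +oo)%E ->
  (* mu << H^alpha restricted to X *)
  (forall E, measurable E -> hausdorff alpha (E `&` X) = 0%E -> mu E = 0%E) ->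
  (admits_frame_measure mu -> p 0%N = p N.-1) /\
  (alpha = 1 -> admits_frame_measure mu ->
     (forall j, (j < N)%N -> p j <= lam) /\ p 0%N = lam /\ p N.-1 = lam).
Proof.
move=> l0 l1 b0 bN binc p0 _ X0 cX XE muE _ _ _ ac.
(* For [N <= 1] the indices [0] and [N.-1] coincide, forcing [1 - lam = 0]. *)
have N1 : (1 < N)%N.
  case: N bN {binc p0 XE muE} => [|[|n]] //=; rewrite b0 => /eqP.
    by rewrite eq_sym subr_eq0 gt_eqF.
  by rewrite eq_sym subr_eq0 gt_eqF.
have N0 : (0 < N)%N by exact: ltnW.
have NN : (N.-1 < N)%N by rewrite prednK.
have N2 : N.-1 = N.-2.+1 by rewrite prednK// -ltnS prednK.
have bmono i j : (i <= j)%N -> (j < N)%N -> b i <= b j.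
  elim: j => [|j IH]; first by rewrite leqn0 => /eqP ->.
  rewrite leq_eqVlt => /orP[/eqP ->//|ij] jN.
  by apply: le_trans (ltW (binc _ jN)); apply: IH => //; exact: ltnW.
have b01 i : (i < N)%N -> 0 <= b i <= 1 - lam.
  move=> iN; rewrite -b0 -bN !bmono//.
  by rewrite -ltnS prednK.
have X01 := attractor_itv l0 l1 b01 X0 cX XE.
have mu0 : mu (~` `[0, 1]%classic) = 0%E.
  apply: ac; first exact: measurableC.
  rewrite (_ : _ `&` X = set0) ?hausdorff_set0//.
  by apply/seteqP; split=> x // [nx /X01].
have mu_gt0 (V : set R) : measurable V -> (forall x : R, 0 <= x <= 1 -> V x) -> (0 < mu V)%E.
  move=> mV V01; rewrite lt_neqAle measure_ge0 andbT eq_sym; apply/eqP => V0.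
  have : (mu (~` V) <= mu (~` (`[0%R, 1%R]%classic : set R)))%E.
    apply: le_measure; rewrite ?inE//; try exact: measurableC.
    by move=> x nV; rewrite /= in_itv/= => /V01.
  by rewrite mu0 probability_setC// V0 sube0 leNgt lte_fin ltr01.
(* Applied to neighbourhoods of a fixed point: they contain the image of [[0, 1]] under a high
   iterate. *)
have gt0_near i (V : set R) n : (i < N)%N -> measurable V ->
    (forall x : R, 0 <= x <= 1 -> V (iter n (tau lam (b i)) x)) -> (0 < mu V)%E.
  move=> iN mV V01; apply: lt_le_trans (self_similar_ge p0 muE n iN mV).
  rewrite mule_gt0 ?lte_fin ?exprn_gt0 ?p0// mu_gt0//.
  exact: measurable_preimage_iter_tau.
(* On [[0, 1]], all maps but the first take values at least [b 1], and all but the last take values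
   at most [b N.-2 + lam]. *)
pose U0 : set R := `]-oo, b 1%N[%classic.
pose U1 : set R := `]b N.-2 + lam, +oo[%classic.
have U0P x : U0 x <-> x < b 1%N by rewrite /U0/= in_itv.
have U1P x : U1 x <-> b N.-2 + lam < x by rewrite /U1/= in_itv/= andbT.
have b1 : 0 < b 1%N by rewrite -b0 binc.
have mU0 : measurable U0 by exact: measurable_itv.
have mU1 : measurable U1 by exact: measurable_itv.
have bN2 : b N.-2 + lam < 1.
  by have := binc N.-2; rewrite -N2 NN bN => /(_ isT); lra.
have end0 : is_end_map lam b p mu 0 U0.
  move=> n S mS SU; apply: (self_similar_end l0 p0 muE N0 mu0 _ _ mS SU).
  - move=> j x jN j0 /andP[x0 _]; rewrite U0P /tau => xb.
    have : b 1%N <= b j by apply: bmono => //; rewrite lt0n.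
    by have := mulr_ge0 (ltW l0) x0; lra.
  - move=> x; rewrite !U0P /tau b0 => xb.
    have [x0|x0] := leP 0 x; first by have := ler_wpM2r x0 (ltW l1); lra.
    have : lam * x < 0 by rewrite pmulr_rlt0.
    by lra.
have end1 : is_end_map lam b p mu N.-1 U1.
  move=> n S mS SU; apply: (self_similar_end l0 p0 muE NN mu0 _ _ mS SU).
  - move=> j x jN j0 /andP[_ x1]; rewrite U1P /tau => xb.
    have : b j <= b N.-2.
      apply: bmono; last by rewrite -N2 leq_pred.
      by rewrite -ltnS -N2 ltn_neqAle j0 -ltnS prednK.
    by have := ler_wpM2l (ltW l0) x1; lra.
  - move=> x; rewrite !U1P /tau bN => xb.
    have := ler_wpM2l (ltW l0) (ltW xb).
    have : 0 < (1 - lam) * (1 - (b N.-2 + lam)) by rewrite mulr_gt0// subr_gt0.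
    by lra.
have muU0 : (0 < mu U0)%E.
  have [n nb] := exists_expr_lt (ltW l0) l1 b1.
  apply: (gt0_near 0%N _ n) => // x /andP[x0 x1]; rewrite U0P iter_tauE.
  rewrite (_ : iter n _ 0 = 0); last first.
    by elim: (n) => //= k ->; rewrite /tau b0 mulr0 addr0.
  by rewrite addr0 (le_lt_trans _ nb)// ler_piMr// exprn_ge0// ltW.
have muU1 : (0 < mu U1)%E.
  have [|n nb] := @exists_expr_lt _ lam (1 - (b N.-2 + lam)) (ltW l0) l1.
    by rewrite subr_gt0.
  apply: (gt0_near N.-1 _ n) => // x /andP[x0 x1]; rewrite U1P iter_tauE.
  (* The last map fixes 1, and its iterates shrink the distance from 0 to 1 by [lam] each time. *)
  rewrite (_ : iter n _ 0 = 1 - lam ^+ n); last first.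
    by elim: (n) => [|k IH]; rewrite ?iterS ?IH ?expr0 ?subrr// /tau bN exprS; ring.
  have : 0 <= lam ^+ n * x by rewrite mulr_ge0// exprn_ge0// ltW.
  by lra.
have part1 : admits_frame_measure mu -> p 0%N = p N.-1.
  move=> fr; apply/le_anti/andP; split.
    exact: (frame_weight_le l0 p0 muE NN N0 mU1 muU1 end1 fr).
  exact: (frame_weight_le l0 p0 muE N0 NN mU0 muU0 end0 fr).
split=> // a1 fr.
have mul : mu `<< leb.
  move=> Z Z0 S mS SZ; apply: ac => //; rewrite a1.
  by apply: hausdorff1_leb0; exact: Z0.
(* Choosing [D] inside [U0] makes it serve both the upper bound for all weights and the lower bound
   at the first map; the last weight follows from (i). *)
have [D [m [M [mD DU D0 m0 [M0 DP]]]]] := density_bounds mul mU0 muU0.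
have ple j : (j < N)%N -> p j <= lam.
  by move=> jN; exact: (frame_weight_le_ratio l0 p0 muE mD D0 m0 M0 DP jN fr).
have p0E : p 0%N = lam.
  apply/le_anti; rewrite ple//=.
  exact: (frame_weight_ge_ratio l0 p0 muE mD D0 m0 M0 DP N0 DU end0 fr).
by split=> //; split=> //; rewrite -part1.
Qed.
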